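(* Let $G_1$ be an $r_1$-regular graph with $r_1\ge1$ on $n_1$ vertices and $m_1$ edges, and let $G_2$ be an $r_2$-regular graph with $r_2\ge1$ on $n_2$ vertices. Let $0=\mu_1,\mu_2,\ldots,\mu_{n_1}$ and $0=\nu_1,\nu_2,\ldots,\nu_{n_2}$ be the normalized Laplacian eigenvalues of $G_1$ and $G_2$, respectively. Then the numbers of spanning trees satisfy $$t(G_1\dot{\vee}G_2)=2^{m_1-n_1+1}\prod_{i=2}^{n_1}(2n_2+r_1\mu_i)\prod_{j=2}^{n_2}(n_1+r_2\nu_j)$$ and $$t(G_1\veebar G_2)=r_1^{\,n_1}(2+n_2)^{m_1-n_1}\prod_{i=2}^{n_1}(n_2+\mu_i)\prod_{j=2}^{n_2}(m_1+r_2\nu_j).$$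
   Context: All graphs are finite and simple; $t(G)$ denotes the number of spanning trees of $G$. For a graph $G$ without isolated vertices, with adjacency matrix $A(G)$ and diagonal degree matrix $D(G)$, the normalized Laplacian matrix is $\mathcal{L}(G)=I-D(G)^{-1/2}A(G)D(G)^{-1/2}$, and its eigenvalues are its normalized Laplacian eigenvalues. The subdivision graph $S(G)$ of $G$ is obtained by inserting a new vertex into every edge of $G$; the set of these new vertices is denoted $I(G)$. The subdivision-vertex join $G_1\dot{\vee}G_2$ is the graph obtained from $S(G_1)$ and a disjoint copy of $G_2$ by joining each vertex of $V(G_1)$ with every vertex of $V(G_2)$. The subdivision-edge join $G_1\veebar G_2$ is the graph obtained from $S(G_1)$ and a disjoint copy of $G_2$ by joining each vertex of $I(G_1)$ with every vertex of $V(G_2)$. *)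

(* Defs.v *)
From HB Require Import structures.
From mathcomp Require Import all_boot all_order all_algebra.
Set Implicit Arguments. Unset Strict Implicit. Unset Printing Implicit Defensive.
Import Order.TTheory GRing.Theory Num.Theory.

Definition simple_graph (V : finType) (e : rel V) : Prop :=
  symmetric e /\ irreflexive e.

Definition deg (V : finType) (e : rel V) (v : V) : nat := #|[set w | e v w]|.

Definition regular (V : finType) (e : rel V) (r : nat) : Prop :=
  forall v, deg e v = r.

Definition is_edge (V : finType) (e : rel V) (A : {set V}) : bool :=
  [exists x, exists y, e x y && (A == [set x; y])].

Definition edge_set (V : finType) (e : rel V) : {set {set V}} :=
  [set A | is_edge e A].

(* The type of edges of the graph (used as the new subdivision vertices). *)
Definition edge_t (V : finType) (e : rel V) := {A : {set V} | is_edge e A}.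

Definition trel (V : finType) (T : {set {set V}}) : rel V :=
  fun x y => [set x; y] \in T.

(* T is a spanning tree of (V,e): a set of edges of the graph such that
   the spanning subgraph (V,T) is connected and acyclic (no edge of T lies on
   a cycle, i.e. removing any edge {x,y} of T disconnects x from y). *)
Definition spanning_tree (V : finType) (e : rel V) (T : {set {set V}}) : bool :=
  [&& T \subset edge_set e,
      [forall x, forall y, connect (trel T) x y] &
      [forall A in T, forall x, forall y,
         (A == [set x; y]) ==> ~~ connect (trel (T :\ A)) x y]].

Definition num_spanning_trees (V : finType) (e : rel V) : nat :=
  #|[set T : {set {set V}} | spanning_tree e T]|.

Local Open Scope ring_scope.
Definition adj_mx (R : rcfType) (n : nat) (e : rel 'I_n) : 'M[R]_n :=
  \matrix_(i, j) (e i j)%:R.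

Definition nlap (R : rcfType) (n : nat) (e : rel 'I_n) : 'M[R]_n :=
  \matrix_(i, j) ((i == j)%:R
     - (e i j)%:R / (Num.sqrt (deg e i)%:R * Num.sqrt (deg e j)%:R)).

Local Close Scope ring_scope.
(* Vertex set of S(G1) together with G2: V(G1) + I(G1) + V(G2). *)
Definition join_vert (n1 n2 : nat) (e1 : rel 'I_n1) : finType :=
  (('I_n1 + edge_t e1) + 'I_n2)%type.

Definition svjoin (n1 n2 : nat) (e1 : rel 'I_n1) (e2 : rel 'I_n2)
  : rel (join_vert n2 e1) :=
  fun a b =>
    match a, b with
    | inl (inl x), inl (inr A) => x \in val A
    | inl (inr A), inl (inl x) => x \in val A
    | inr y, inr y' => e2 y y'
    | inl (inl _), inr _ => true
    | inr _, inl (inl _) => true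
    | _, _ => false
    end.

Definition sejoin (n1 n2 : nat) (e1 : rel 'I_n1) (e2 : rel 'I_n2)
  : rel (join_vert n2 e1) :=
  fun a b =>
    match a, b with
    | inl (inl x), inl (inr A) => x \in val A
    | inl (inr A), inl (inl x) => x \in val A
    | inr y, inr y' => e2 y y'
    | inl (inr _), inr _ => true
    | inr _, inl (inr _) => true
    | _, _ => false
    end.

Arguments svjoin {n1 n2} e1 e2 _ _.
Arguments sejoin {n1 n2} e1 e2 _ _.
Arguments nlap R {n} e.

(* Main.v *)
Require Import Defs.
From HB Require Import structures.
From mathcomp Require Import all_boot all_order all_algebra.
From mathcomp Require Import ring.
Import Order.TTheory GRing.Theory Num.Theory.
Set Implicit Arguments. Unset Strict Implicit. Unset Printing Implicit Defensive.

(** The number of spanning trees is read off a determinant of the Laplacian [L].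

    Matrix-tree theorem: for a nonempty set [S] of roots, the number of spanning
    forests with one root in each component and the determinant of [L] with the
    rows and columns of [S] deleted satisfy the same recursion.  If [xy] is an
    edge with [x] in [S] and [y] outside, both are the sum of their values for
    [(E - xy, S)] and [(E - xy, S + y)]; if no edge leaves [S], both are [0],
    or [1] when [S] is everything.

    Since [L] has zero row and column sums, [det (L + u v^T)] is the number of
    spanning trees times the sums of the entries of [u] and of [v].  For a join,
    let [u] be the indicator of the vertices of [S(G1)] that are joined to [G2],
    and [v] that of [V(G2)]: then [u v^T] cancels one off-diagonal block of [L].
    The two diagonal blocks are evaluated with [B B^T = r1 I + A(G1)], where [B]
    is the incidence matrix, and [A = r (I - nlap)]. *)

(** * Rooted spanning forests *)

Section RootedForests.

Variable V : finType.
Implicit Types (T E : {set {set V}}) (S A : {set V}).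

(** All roots are made mutually adjacent, which contracts [S] to a single vertex: a rooted forest is
    then a spanning tree of the contracted graph, described by the same connectivity and cut
    conditions. *)
Definition rooted_rel T S : rel V :=
  fun x y => trel T x y || (x \in S) && (y \in S).

Definition rooted_forest E S T : bool :=
  [&& T \subset E,
      [forall x, forall y, connect (rooted_rel T S) x y] &
      [forall A in T, forall x, forall y,
         (A == [set x; y]) ==> ~~ connect (rooted_rel (T :\ A) S) x y]].

Definition num_rooted_forests E S : nat := #|[set T | rooted_forest E S T]|.

Lemma trel_sym T : symmetric (trel T).
Proof. by move=> x y; rewrite /trel setUC. Qed.

Lemma rooted_rel_sym T S : symmetric (rooted_rel T S).
Proof. by move=> x y; rewrite /rooted_rel trel_sym andbC. Qed.

Lemma eq_set2 (a b c d : V) :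
  ([set a; b] == [set c; d]) = (a == c) && (b == d) || (a == d) && (b == c).
Proof.
apply/eqP/idP => [H|/orP[]/andP[/eqP-> /eqP->] //]; last by rewrite setUC.
have : a \in [set c; d] by rewrite -H !inE eqxx.
have : b \in [set c; d] by rewrite -H !inE eqxx orbT.
have : c \in [set a; b] by rewrite H !inE eqxx.
have : d \in [set a; b] by rewrite H !inE eqxx orbT.
rewrite !inE (eq_sym c) (eq_sym c) (eq_sym d) (eq_sym d).
by case: (a == c); case: (a == d); case: (b == c); case: (b == d).
Qed.

(** A single root only adds a loop, so spanning trees are the forests rooted at any one vertex. *)
Lemma connect_rooted1 T r :
  connect (rooted_rel T [set r]) =2 connect (trel T).
Proof.
move=> x y; apply/idP/idP; apply: connect_sub => u v; last first.
  by move=> uv; apply: connect1; rewrite /rooted_rel uv.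
case/orP => [uv|]; first exact: connect1.
by rewrite !inE => /andP[/eqP-> /eqP->].
Qed.

Lemma num_spanning_trees_rooted (e : rel V) r :
  num_spanning_trees e = num_rooted_forests (edge_set e) [set r].
Proof.
apply: eq_card => T; rewrite !inE /spanning_tree /rooted_forest.
congr [&& _, _ & _].
  by apply: eq_forallb => x; apply: eq_forallb => y; rewrite connect_rooted1.
apply: eq_forallb => A; congr (_ ==> _).
apply: eq_forallb => x; apply: eq_forallb => y; congr (_ ==> ~~ _).
by rewrite connect_rooted1.
Qed.

(** Adding the edge [xy] and adding the root [y] both attach [y] to the class of [S]; a step of
    either relation is at most two steps of the other. *)
Lemma connect_rootedU1 T S x y : x \in S ->
  connect (rooted_rel ([set x; y] |: T) S) =2 connect (rooted_rel T (y |: S)).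
Proof.
move=> xS u v; apply/idP/idP; apply: connect_sub => {u v} u v.
  move=> uv; apply: connect1; move: uv; rewrite /rooted_rel /trel !inE.
  rewrite eq_set2 => /orP[/orP[/orP[]/andP[/eqP-> /eqP->]|->//]|/andP[-> ->]].
  - by rewrite eqxx xS !orbT.
  - by rewrite eqxx xS !orbT.
  by rewrite !orbT.
have Axy : rooted_rel ([set x; y] |: T) S x y.
  by rewrite /rooted_rel /trel !inE eqxx.
have Ayx : rooted_rel ([set x; y] |: T) S y x by rewrite rooted_rel_sym.
have SS a b : a \in S -> b \in S -> rooted_rel ([set x; y] |: T) S a b.
  by move=> aS bS; rewrite /rooted_rel aS bS orbT.
case/orP => [uv|]; first by apply: connect1; rewrite /rooted_rel /trel inE [_ \in T]uv orbT.
rewrite !inE => /andP[/predU1P[->|uS] /predU1P[->|vS]].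
- exact: connect0.
- exact: connect_trans (connect1 Ayx) (connect1 (SS _ _ xS vS)).
- exact: connect_trans (connect1 (SS _ _ uS xS)) (connect1 Axy).
exact/connect1/SS.
Qed.

(* Cutting the first edge of a simple path from [y] to [S] leaves its endpoints
   connected once [y] is a root, so a forest rooted at [y |: S] has no such path. *)
Lemma rooted_forest_separated E S T x y : x \in S -> y \notin S ->
  rooted_forest E (y |: S) T -> ~~ connect (rooted_rel T S) y x.
Proof.
move=> xS yS /and3P[_ _ /forall_inP acyc]; apply/negP => /connectP[p0 pth lst].
have {p0 pth lst} : exists2 p, path (rooted_rel T S) y p & uniq (y :: p) /\ x = last y p.
  by case/shortenP: pth lst => p *; exists p.
case=> -[|z p] /=; first by move=> _ [_ xy]; rewrite -xy xS in yS.
case/andP => yz pth [/andP[ynzp /andP[znp _]] lst].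
have {}yz : [set y; z] \in T by case/orP: yz => //; rewrite (negbTE yS).
have /forallP/(_ y)/forallP/(_ z) := acyc _ yz; rewrite eqxx /= => /negP; apply.
set e := rooted_rel _ _.
have pth' : path e z p.
  apply: sub_in_path pth; last exact: (allss (z :: p)).
  move=> u v; rewrite /= => uzp vzp /orP[uv|/andP[uS vS]]; last first.
    by rewrite /e /rooted_rel !inE uS vS !orbT.
  rewrite /e /rooted_rel /trel !inE [_ \in T]uv andbT eq_set2.
  have /negbTE -> : u != y by apply: contraNneq ynzp => <-.
  have /negbTE -> // : v != y by apply: contraNneq ynzp => <-.
  by rewrite !andbF.
have ezx : connect e z x by apply/connectP; exists p.
rewrite (sym_connect_sym (rooted_rel_sym _ _)); apply: connect_trans ezx (connect1 _).
by rewrite /e /rooted_rel !inE eqxx xS !orbT.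
Qed.

(** Deletion and contraction: forests avoiding [xy] are those of the smaller edge set, and forests
    containing it arise as [A |: T'] from forests in which [y] has become a root. *)
Lemma num_rooted_forests_rec E S x y :
  x \in S -> y \notin S -> [set x; y] \in E ->
  num_rooted_forests E S =
    (num_rooted_forests (E :\ [set x; y]) S +
     num_rooted_forests (E :\ [set x; y]) (y |: S))%N.
Proof.
move=> xS yS; set A := [set x; y] => AE.
rewrite {1}/num_rooted_forests -(cardsID [set T : {set {set V}} | A \in T]) addnC.
congr addn.
  apply: eq_card => T; rewrite !inE /rooted_forest subsetD1.
  by case: (A \in T) => /=; rewrite ?andbF ?andbT.
have inj : {in [set T | rooted_forest (E :\ A) (y |: S) T] &, injective (fun T => A |: T)}.
  move=> T T'; rewrite !inE => /and3P[TE _ _] /and3P[TE' _ _] eqT.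
  move: TE TE'; rewrite !subsetD1 => /andP[_ AT] /andP[_ AT'].
  by rewrite -(setU1K AT) eqT setU1K.
rewrite /num_rooted_forests -(card_in_imset inj); apply: eq_card => T.
have forestE T' : A \notin T' ->
    rooted_forest E S (A |: T') = rooted_forest (E :\ A) (y |: S) T'.
  move=> AT'; have sub : (A |: T' \subset E) = (T' \subset E :\ A).
    by rewrite subUset sub1set AE /= subsetD1 AT' andbT.
  apply/idP/idP => frst; have /and3P[Ts conn /forall_inP acyc] := frst; apply/and3P; split.
  - by rewrite -sub.
  - apply/forallP => u; apply/forallP => v.
    by rewrite -(connect_rootedU1 _ _ xS); move/forallP/(_ u)/forallP: conn; apply.
  - apply/forall_inP => B BT'; apply/forallP => u; apply/forallP => v; apply/implyP => BE.
    have BA : B != A by apply: contraNneq AT' => <-.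
    have /acyc/forallP/(_ u)/forallP/(_ v) : B \in A |: T' by rewrite inE BT' orbT.
    rewrite BE /= setDUl (_ : [set A] :\: [set B] = [set A]) ?connect_rootedU1 //.
    by apply/setDidPl; rewrite disjoints1 inE eq_sym.
  - by rewrite sub.
  - apply/forallP => u; apply/forallP => v.
    by rewrite connect_rootedU1 //; move/forallP/(_ u)/forallP: conn; apply.
  apply/forall_inP => B; rewrite in_setU1 => BT'.
  apply/forallP => u; apply/forallP => v; apply/implyP => BE.
  (* For the new edge itself, acyclicity says that [T'] does not already link [y] to [S]; this is
     the separation lemma. *)
  have [BA|BA] := eqVneq B A.
    rewrite BA setU1K //; move: BE; rewrite BA eq_set2.
    have ns := rooted_forest_separated xS yS frst.
    case/orP => /andP[/eqP<- /eqP<-] //.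
    by rewrite (sym_connect_sym (rooted_rel_sym _ _)).
  rewrite setDUl (_ : [set A] :\: [set B] = [set A]); last first.
    by apply/setDidPl; rewrite disjoints1 inE eq_sym.
  rewrite connect_rootedU1 //; rewrite (negbTE BA) in BT'.
  by move/forallP: (acyc _ BT') => /(_ u)/forallP/(_ v); rewrite BE.
apply/idP/imsetP => [|[T']]; rewrite !inE.
  case/andP=> frst AT; exists (T :\ A); last by rewrite setD1K.
  by rewrite inE -forestE ?setD1K // !inE eqxx.
move=> frst ->; rewrite !inE eqxx andbT forestE //.
by case/and3P: frst; rewrite subsetD1 => /andP[].
Qed.

(** When every vertex is a root, the ends of any edge stay connected after its removal, so only the
    empty forest is acyclic. The cut condition constrains only sets of the form [[set x; y]], hence
    the hypothesis on [E]. *)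
Lemma num_rooted_forestsT E : (forall A, A \in E -> exists x y, A = [set x; y]) ->
  num_rooted_forests E setT = 1%N.
Proof.
move=> E2; rewrite /num_rooted_forests -(cards1 (set0 : {set {set V}})).
have full T x y : connect (rooted_rel T setT) x y.
  by apply: connect1; rewrite /rooted_rel !inE orbT.
apply: eq_card => T; rewrite !inE; apply/idP/eqP => [/and3P[TE _ /forall_inP acyc]|->].
  apply/setP => A; rewrite inE; apply/negP => AT.
  have [x [y Axy]] := E2 _ (subsetP TE _ AT).
  by have /forallP/(_ x)/forallP/(_ y) := acyc _ AT; rewrite full Axy eqxx.
apply/and3P; split; first exact: sub0set.
  by apply/forallP => x; apply/forallP => y.
by apply/forall_inP => A; rewrite inE.
Qed.

Lemma num_rooted_forests_closed E S x y : x \in S -> y \notin S ->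
  (forall u v, u \in S -> v \notin S -> [set u; v] \notin E) ->
  num_rooted_forests E S = 0%N.
Proof.
move=> xS yS cl; apply/eqP; rewrite cards_eq0; apply/eqP/setP => T.
rewrite !inE; apply/negP => /and3P[TE /forallP/(_ x)/forallP/(_ y) xy _].
have SE : closed (rooted_rel T S) S.
  apply: (intro_closed (sym_connect_sym (rooted_rel_sym _ _))) => u v.
  case/orP => [uv uS|/andP[]] //; apply: contraTT uv => vS.
  by apply: contra (cl _ _ uS vS); apply: (subsetP TE).
by rewrite -(closed_connect SE xy) xS in yS.
Qed.
End RootedForests.

Local Open Scope ring_scope.

(** * The matrix-tree theorem *)

Lemma sum_deltal (R : pzRingType) (I : finType) (i : I) (F : I -> R) :
  \sum_j (i == j)%:R * F j = F i.
Proof.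
rewrite (bigD1 i) //= eqxx mul1r big1 ?addr0 // => j.
by rewrite eq_sym => /negbTE ->; rewrite mul0r.
Qed.

Lemma sum_deltar (R : pzRingType) (I : finType) (i : I) (F : I -> R) :
  \sum_j F j * (j == i)%:R = F i.
Proof.
rewrite (bigD1 i) //= eqxx mulr1 big1 ?addr0 // => j.
by move=> /negbTE ->; rewrite mulr0.
Qed.

(** * Minors and rank-one perturbations of a matrix with zero row and column sums *)

Section Determinants.

Variables (R : comNzRingType) (n : nat).
Implicit Types (A L : 'M[R]_n) (k : 'I_n).

Lemma det_row_delta A k c : (forall j, A k j = c * (j == k)%:R) ->
  \det A = c * \det (row' k (col' k A)).
Proof.
move=> Ak; rewrite (expand_det_row _ k) (bigD1 k) //= big1 => [|j jk].
  by rewrite Ak eqxx mulr1 addr0 /cofactor addnn -signr_odd odd_double expr0 mul1r.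
by rewrite Ak (negbTE jk) mulr0 mul0r.
Qed.

Lemma det_row_delta1 A k c : (forall j, A k j = c * (j == k)%:R) ->
  (forall i j, i != k -> j != k -> A i j = (i == j)%:R) -> \det A = c.
Proof.
move=> Ak A1; rewrite (det_row_delta Ak) (_ : row' _ _ = 1%:M) ?det1 ?mulr1 //.
apply/matrixP => i j; rewrite !mxE A1 ?(inj_eq lift_inj) //.
  by rewrite eq_sym neq_lift.
by rewrite eq_sym neq_lift.
Qed.

(* [P] replaces row [k] by the sum of all rows, which makes row and column [k] of
   [P *m L *m P^T] vanish; the rest is [X *m N *m Y] with [N] the block sum of [1]
   at [k] and the minor. *)
Lemma det_add_rank1 L (u : 'cV[R]_n) (v : 'rV[R]_n) k :
  (forall i, \sum_j L i j = 0) -> (forall j, \sum_i L i j = 0) ->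
  \det (L + u *m v) =
    (\sum_i u i 0) * (\sum_j v 0 j) * \det (row' k (col' k L)).
Proof.
move=> rows cols.
pose P : 'M[R]_n := \matrix_(i, j) if i == k then 1 else (i == j)%:R.
(* Column [k] of [X] is [P *m u] and row [k] of [Y] is [v *m P^T]; elsewhere both agree with the
   identity. Hence the entry 1 of [N] at [k] produces the rank-one term, and the rest of [N] is left
   unchanged. *)
pose X : 'M[R]_n := \matrix_(i, j)
  if j == k then (if i == k then \sum_l u l 0 else u i 0) else (i == j)%:R.
pose Y : 'M[R]_n := \matrix_(i, j)
  if i == k then (if j == k then \sum_l v 0 l else v 0 j) else (i == j)%:R.
pose N : 'M[R]_n := \matrix_(i, j)
  if (i == k) || (j == k) then (i == j)%:R else L i j.
have detP : \det P = 1.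
  rewrite -det_tr; apply: (@det_row_delta1 _ k) => [j|i j ik jk]; rewrite !mxE.
    by case: (j == k); rewrite mul1r.
  by rewrite (negbTE jk) eq_sym.
have detX : \det X = \sum_i u i 0.
  apply: (@det_row_delta1 _ k) => [j|i j ik jk]; rewrite !mxE.
    by rewrite eqxx eq_sym; case: (k == j); rewrite ?mulr1 ?mulr0.
  by rewrite (negbTE jk).
have detY : \det Y = \sum_j v 0 j.
  rewrite -det_tr; apply: (@det_row_delta1 _ k) => [j|i j ik jk]; rewrite !mxE.
    by rewrite eqxx; case: (j == k); rewrite ?mulr1 ?mulr0.
  by rewrite (negbTE jk) eq_sym.
have detN : \det N = \det (row' k (col' k L)).
  rewrite (@det_row_delta N k 1) => [|j]; last by rewrite !mxE eqxx mul1r eq_sym.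
  rewrite mul1r; congr (\det _); apply/matrixP => i j; rewrite !mxE.
  by rewrite ![_ == k]eq_sym !(negbTE (neq_lift _ _)).
have PL (Z : 'M[R]_n) i j : (P *m Z) i j = if i == k then \sum_l Z l j else Z i j.
  rewrite mxE; case: ifP => ik.
    by apply: eq_bigr => l _; rewrite mxE ik mul1r.
  by rewrite -[RHS](sum_deltal i (fun l => Z l j)); apply: eq_bigr => l _; rewrite mxE ik.
have PR (Z : 'M[R]_n) i j :
    (Z *m P^T) i j = if j == k then \sum_l Z i l else Z i j.
  rewrite -[Z]trmxK -trmx_mul mxE PL.
  case: ifP => _; last by rewrite !mxE.
  by apply: eq_bigr => l _; rewrite !mxE.
have XL (Z : 'M[R]_n) i j : (X *m Z) i j =
    (if i == k then 0 else Z i j) + (if i == k then \sum_l u l 0 else u i 0) * Z k j.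
  rewrite mxE (bigD1 k) //= mxE eqxx addrC; congr (_ + _).
  under eq_bigr => l lk do rewrite mxE (negbTE lk).
  have [->|ik] := eqVneq i k.
    by rewrite big1 // => l lk; rewrite eq_sym (negbTE lk) mul0r.
  rewrite (bigD1 i) //= eqxx mul1r big1 ?addr0 // => l /andP[_ li].
  by rewrite eq_sym (negbTE li) mul0r.
have YR (Z : 'M[R]_n) i j : (Z *m Y) i j =
    (if j == k then 0 else Z i j) + Z i k * (if j == k then \sum_l v 0 l else v 0 j).
  rewrite mxE (bigD1 k) //= mxE eqxx addrC; congr (_ + _).
  under eq_bigr => l lk do rewrite mxE (negbTE lk).
  have [->|jk] := eqVneq j k.
    by rewrite big1 // => l lk; rewrite (negbTE lk) mulr0.
  rewrite (bigD1 j) //= eqxx mulr1 big1 ?addr0 // => l /andP[_ lj].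
  by rewrite (negbTE lj) mulr0.
have uvE i j : (u *m v) i j = u i 0 * v 0 j by rewrite mxE big_ord1.
have key : P *m (L + u *m v) *m P^T = X *m N *m Y.
  apply/matrixP => i j; rewrite PR YR !XL.
  have PLuv l : (P *m (L + u *m v)) i l =
      (if i == k then 0 else L i l) + (if i == k then \sum_l u l 0 else u i 0) * v 0 l.
    rewrite PL; case: ifP => _; last by rewrite mxE uvE.
    under eq_bigr => l' _ do rewrite mxE uvE.
    by rewrite big_split /= cols add0r -mulr_suml add0r.
  rewrite PLuv; under eq_bigr => l _ do rewrite PLuv.
  rewrite big_split /= -mulr_sumr.
  have -> : \sum_l (if i == k then 0 else L i l) = 0.
    by case: (i == k); [rewrite big1|rewrite rows].
  rewrite !mxE !eqxx /= (eq_sym k j) orbT.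
  case: (eqVneq i k) => _; case: (eqVneq j k) => _ /=;
    by rewrite ?mulr0 ?mul0r ?mulr1 ?addr0 ?add0r.
rewrite -detN -detX -detY mulrAC -!det_mulmx -key !det_mulmx det_tr detP.
by rewrite mulr1 mul1r.
Qed.

End Determinants.

(** * Laplacians with a set of roots and their deletion recursion *)

Section MatrixTree.

Variables (R : numFieldType) (V : finType) (n : nat) (f : 'I_n -> V).
Hypothesis f_bij : bijective f.
Implicit Types (E : {set {set V}}) (S : {set V}).

(** A loop cancels between the degree and the diagonal entry, so singletons in an edge set do no
    harm. *)
Definition laplacian (e : rel V) (x y : V) : R :=
  (x == y)%:R * (\sum_z (e x z)%:R) - (e x y)%:R.

(** Rows and columns of [S] are overwritten by those of the identity rather than deleted: the
    determinant is that of the minor, and the size stays [n] as the root set grows. *)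
Definition rooted_lap_mx E S : 'M[R]_n :=
  \matrix_(i, j) if (f i \in S) || (f j \in S) then (i == j)%:R
                 else laplacian (trel E) (f i) (f j).

(** Since column [x] is already trivial, the edge from [x] to [f k] shows only as a 1 in the
    diagonal entry of row [k]. Linearity of the determinant in that row splits it off. *)
Lemma det_rooted_lap_rec E S x k :
  x \in S -> f k \notin S -> [set x; f k] \in E ->
  \det (rooted_lap_mx E S) =
    \det (rooted_lap_mx (E :\ [set x; f k]) S) +
    \det (rooted_lap_mx (E :\ [set x; f k]) (f k |: S)).
Proof.
move=> xS kS; set A := [set x; f k] => AE; set E' := E :\ A.
have f_inj := bij_inj f_bij.
have xk : x != f k by apply: contraNneq kS => <-.
have trelE i z : i \notin S -> i != f k -> trel E i z = trel E' i z.
  move=> iS ik; rewrite /trel !inE eq_set2 (negbTE ik) /=.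
  by have /negbTE -> : i != x by apply: contraNneq iS => ->.
have trelk z : (trel E (f k) z)%:R = (trel E' (f k) z)%:R + (z == x)%:R :> R.
  rewrite /trel !inE eq_set2 eqxx /= [f k == x]eq_sym (negbTE xk) /=.
  have [->|_] := eqVneq z x; last by rewrite addr0.
  by rewrite setUC -/A AE add0r.
(* [N] keeps column [k] so that it differs from the other two matrices in row [k] only; expanding
   along row [k] discards that column, so the determinant is the one with [f k] as a root. *)
pose N : 'M[R]_n := \matrix_(i, j)
  if i == k then (j == k)%:R else rooted_lap_mx E' S i j.
have -> : \det (rooted_lap_mx E' (f k |: S)) = \det N.
  rewrite (@det_row_delta _ _ _ k 1) => [|j]; last first.
    by rewrite !mxE !inE eqxx /= mul1r eq_sym.
  rewrite (@det_row_delta _ _ N k 1) => [|j]; last by rewrite !mxE eqxx mul1r.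
  congr (1 * \det _); apply/matrixP => i j; rewrite !mxE !inE !(inj_eq f_inj).
  by rewrite ![_ == k]eq_sym !(negbTE (neq_lift _ _)).
rewrite -[\det (rooted_lap_mx E' S)]mul1r -[\det N]mul1r.
apply: (determinant_multilinear (i0 := k)).
- apply/rowP => j; rewrite !mxE !mul1r (negbTE kS) eqxx /=.
  case: ifP => jS.
    have /negbTE -> : j != k by apply: contraNneq kS => <-.
    by rewrite addr0.
  rewrite /laplacian (eq_bigr _ (fun z _ => trelk z)) big_split /=.
  rewrite (_ : \sum_z (z == x)%:R = 1 :> R); last first.
    by rewrite -[RHS](sum_deltar x (fun=> 1)); apply: eq_bigr => *; rewrite mul1r.
  have /negbTE jx : f j != x by apply/negP => /eqP jx; rewrite jx xS in jS.
  rewrite trelk jx addr0 mulrDr mulr1 (inj_eq f_inj) eq_sym.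
  by rewrite addrAC.
- apply/matrixP => i j; rewrite !mxE; case: ifP => // /negbT; rewrite negb_or => /andP[iS jS].
  have ik : f (lift k i) != f k by rewrite (inj_eq f_inj) eq_sym neq_lift.
  rewrite /laplacian trelE //; congr (_ * _ - _).
  by apply: eq_bigr => z _; rewrite trelE.
- apply/matrixP => i j; rewrite !mxE [_ == k]eq_sym (negbTE (neq_lift _ _)).
  case: ifP => // /negbT; rewrite negb_or => /andP[iS jS].
  have ik : f (lift k i) != f k by rewrite (inj_eq f_inj) eq_sym neq_lift.
  rewrite /laplacian trelE //; congr (_ * _ - _).
  by apply: eq_bigr => z _; rewrite trelE.
Qed.

Lemma sum_laplacianl e x : \sum_y laplacian e x y = 0.
Proof. by rewrite sumrB sum_deltal subrr. Qed.

Lemma laplacian_sym e x y : symmetric e -> laplacian e x y = laplacian e y x.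
Proof.
move=> es; rewrite /laplacian es eq_sym.
by case: (eqVneq y x) => [->|]; rewrite // !mul0r.
Qed.

(** The indicator of the complement of [S] is a nonzero left kernel vector: with no edge leaving
    [S], the Laplacian block on the complement has zero column sums. *)
Lemma det_rooted_lap_closed E S y : y \notin S ->
  (forall u v, u \in S -> v \notin S -> [set u; v] \notin E) ->
  \det (rooted_lap_mx E S) = 0.
Proof.
move=> yS cl; apply/eqP/det0P; exists (\row_i (f i \notin S)%:R).
  have [g fK gK] := f_bij; apply/eqP => /rowP/(_ (g y)).
  by rewrite !mxE gK yS => /eqP; rewrite oner_eq0.
apply/rowP => j; rewrite !mxE.
have [jS|jS] := boolP (f j \in S).
  rewrite big1 // => i _; rewrite !mxE jS orbT.
  have [->|] := eqVneq i j; first by rewrite jS mul0r.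
  by rewrite mulr0.
rewrite -[RHS](sum_laplacianl (trel E) (f j)) [RHS](reindex f) /=; last first.
  exact: onW_bij.
apply: eq_bigr => i _; rewrite !mxE (negbTE jS) orbF.
have [iS|iS] /= := boolP (f i \in S).
  have /negbTE jfi : f j != f i by apply: contraNneq jS => ->.
  rewrite mul0r /laplacian jfi mul0r sub0r trel_sym.
  by rewrite /trel (negbTE (cl _ _ iS jS)) oppr0.
by rewrite mul1r laplacian_sym //; apply: trel_sym.
Qed.

(** Both terms of the recursion have one edge fewer, so induction on the number of edges works with
    [S] left general. *)
Lemma rooted_matrix_tree E S :
  (forall A, A \in E -> exists x y, A = [set x; y]) -> S != set0 ->
  \det (rooted_lap_mx E S) = (num_rooted_forests E S)%:R.
Proof.
have [m] := ubnP #|E|; elim: m E S => // m IH E S ltEm E2 /set0Pn[x0 x0S].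
have [/exists_inP[x xS /exists_inP[y yS xyE]]|cl] := boolP
    [exists x in S, exists y in ~: S, [set x; y] \in E].
  rewrite inE in yS; have [g fK gK] := f_bij; rewrite -(gK y) in yS xyE.
  have E'E : E :\ [set x; f (g y)] \subset E by apply: subsetDl.
  have ltE' : (#|E :\ [set x; f (g y)]| < m)%N.
    by move: ltEm; rewrite (cardsD1 [set x; f (g y)] E) xyE.
  rewrite (det_rooted_lap_rec xS yS xyE) (num_rooted_forests_rec xS yS xyE) natrD.
  have E2' A : A \in E :\ [set x; f (g y)] -> exists x y, A = [set x; y].
    by move/(subsetP E'E); apply: E2.
  by rewrite !IH //; apply/set0Pn; exists x; rewrite ?inE xS ?orbT.
have {}cl u v : u \in S -> v \notin S -> [set u; v] \notin E.
  move=> uS vS; apply: contra cl => uvE.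
  by apply/exists_inP; exists u => //; apply/exists_inP; exists v; rewrite ?inE.
have [->|] := eqVneq S setT.
  rewrite num_rooted_forestsT // (_ : rooted_lap_mx _ _ = 1%:M) ?det1 //.
  by apply/matrixP => i j; rewrite !mxE !inE.
rewrite -subTset => /subsetPn[y _ yS].
by rewrite (det_rooted_lap_closed yS cl) (num_rooted_forests_closed x0S yS cl).
Qed.

Lemma edge_set_trel (e : rel V) : symmetric e -> trel (edge_set e) =2 e.
Proof.
move=> es x y; rewrite /trel inE; apply/existsP/idP => [[u /existsP[v]]|exy].
  by case/andP => euv; rewrite eq_set2 => /orP[]/andP[/eqP-> /eqP->] //; rewrite es.
by exists x; apply/existsP; exists y; rewrite exy eqxx.
Qed.

(** The weights [u] and [v] are kept free so that they can later be chosen to cancel an off-diagonal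
    block of the Laplacian of a join. *)
Lemma matrix_tree (e : rel V) (u v : V -> R) : symmetric e -> (0 < n)%N ->
  \det (\matrix_(i < n, j < n) (laplacian e (f i) (f j) + u (f i) * v (f j))) =
    (\sum_x u x) * (\sum_y v y) * (num_spanning_trees e)%:R.
Proof.
move=> es n_gt0; have f_inj := bij_inj f_bij; have f_onW := onW_bij predT f_bij.
pose k := Ordinal n_gt0; pose L : 'M[R]_n := \matrix_(i, j) laplacian e (f i) (f j).
have rows i : \sum_j L i j = 0.
  rewrite -[RHS](sum_laplacianl e (f i)) [RHS](reindex f) //=.
  by apply: eq_bigr => j _; rewrite mxE.
have cols j : \sum_i L i j = 0.
  by rewrite -[RHS](rows j); apply: eq_bigr => i _; rewrite !mxE laplacian_sym.
transitivity (\det (L + (\col_i u (f i)) *m (\row_j v (f j)))).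
  by congr (\det _); apply/matrixP => i j; rewrite !mxE big_ord1 !mxE.
rewrite (det_add_rank1 _ _ k rows cols) (reindex f) //= [\sum_y v y](reindex f) //=.
congr (_ * _ * _); [by apply: eq_bigr => i _; rewrite mxE..|].
rewrite (num_spanning_trees_rooted e (f k)) -rooted_matrix_tree; last first.
- by apply/set0Pn; exists (f k); rewrite inE.
- move=> A; rewrite inE => /existsP[x /existsP[y /andP[_ /eqP ->]]].
  by exists x, y.
rewrite [RHS](@det_row_delta _ _ _ k 1) => [|j]; last first.
  by rewrite !mxE !inE eqxx /= mul1r eq_sym.
rewrite mul1r; congr (\det _); apply/matrixP => i j; rewrite !mxE !inE !(inj_eq f_inj).
rewrite ![_ == k]eq_sym !(negbTE (neq_lift _ _)) /= /laplacian edge_set_trel //.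
by congr (_ * _ - _); apply: eq_bigr => z _; rewrite edge_set_trel.
Qed.

End MatrixTree.

(** * Block determinants and incidence matrices *)

(** Comparing degrees shows that [s] lists the other [n - 1] eigenvalues and that [n] is
    positive. *)
Lemma size_char_poly_roots (R : idomainType) n (L : 'M[R]_n) (s : seq R) :
  char_poly L = 'X * \prod_(x <- s) ('X - x%:P) -> n = (size s).+1.
Proof.
move=> Ls; have := size_char_poly L; rewrite Ls size_monicM ?monicX //; last first.
  by rewrite -size_poly_eq0 size_prod_XsubC.
by rewrite size_polyX size_prod_XsubC => -[].
Qed.

Lemma char_poly_horner (R : comNzRingType) n (L : 'M[R]_n) (a : R) :
  (char_poly L).[a] = \det (a%:M - L).
Proof.
rewrite -[LHS]horner_evalE -det_map_mx; congr (\det _).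
apply/matrixP => i j; rewrite !mxE /= horner_evalE.
by rewrite hornerD hornerN hornerC hornerMn hornerX.
Qed.

(** The determinant is [(- r) ^+ n] times the characteristic polynomial at [- c / r]; the root 0
    accounts for the separate factor [c]. *)
Lemma det_scalar_add_char_poly (R : fieldType) n (L : 'M[R]_n) (s : seq R) (c r : R) :
  r != 0 -> char_poly L = 'X * \prod_(x <- s) ('X - x%:P) ->
  \det (c%:M + r *: L) = c * \prod_(x <- s) (c + r * x).
Proof.
move=> r0 Ls; have En := size_char_poly_roots Ls.
have -> : c%:M + r *: L = (- r) *: ((- c / r)%:M - L).
  rewrite scalerBr scale_scalar_mx scaleNr opprK; congr (_%:M + _).
  by field.
rewrite detZ -char_poly_horner Ls hornerM hornerX [in X in _ ^+ X]En exprS.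
have -> : \prod_(x <- s) (c + r * x) =
    (- r) ^+ size s * (\prod_(x <- s) ('X - x%:P)).[- c / r].
  elim: (s) => [|x t IH] /=; first by rewrite !big_nil hornerC mulr1.
  rewrite !big_cons hornerM hornerXsubC IH exprS.
  by field.
by field.
Qed.

(** Schur complement: a unit lower triangular factor clears the lower left block. Pulling [b] out of
    the [n] remaining rows gives the exponent, an integer because [m] may be smaller than [n]. *)
Lemma det_bipartite_block (R : fieldType) n m (B : 'M[R]_(n, m)) (a b : R) : b != 0 ->
  \det (block_mx a%:M (- B) (- B^T) b%:M) =
    b ^ (m%:Z - n%:Z) * \det ((a * b)%:M - B *m B^T).
Proof.
move=> b0.
have detl : \det (block_mx 1%:M 0 (b^-1 *: B^T) 1%:M : 'M[R]_(n + m)) = 1.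
  by rewrite det_lblock !det1 mulr1.
rewrite -[LHS]mulr1 -detl -det_mulmx mulmx_block !mulmx0 !mulmx1 !add0r.
rewrite mul_scalar_mx scalerA divff // scale1r addNr det_ublock det_scalar.
have -> : (a * b)%:M - B *m B^T = b *: (a%:M + - B *m (b^-1 *: B^T)).
  rewrite scalerDr scale_scalar_mx -scalemxAr scalerA divff // scale1r mulNmx.
  by rewrite mulrC.
by rewrite detZ mulrA -[b ^+ n]/(b ^ n%:Z) -expfzDr // subrK mulrC.
Qed.

(** * Counting incidences between vertices and edges *)

Section Incidence.

Variables (R : numFieldType) (V : finType) (e : rel V).
Hypothesis e_simple : simple_graph e.

Lemma edge_tP (A : edge_t e) : exists x y, [/\ e x y, x != y & val A = [set x; y]].
Proof.
case: A => A /= /existsP[x /existsP[y /andP[exy /eqP AE]]]; exists x, y; split=> //.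
by apply/eqP => xy; rewrite xy e_simple.2 in exy.
Qed.

Lemma card_edge (A : edge_t e) : #|val A| = 2%N.
Proof. by have [x [y [_ xy ->]]] := edge_tP A; rewrite cards2 xy. Qed.

Lemma sum_edge_vertices (A : edge_t e) : \sum_x (x \in val A)%:R = 2 :> R.
Proof.
rewrite -natr_sum -(card_edge A) -sum1_card; congr _%:R; rewrite [RHS]big_mkcond.
by apply: eq_bigr => x _; case: (x \in _).
Qed.

(** An edge containing two distinct vertices is the pair they form, so at most one term is nonzero.
    These are the off-diagonal entries of the product of the incidence matrix and its transpose. *)
Lemma sum_edges_pair x y : x != y ->
  \sum_(A : edge_t e) (x \in val A)%:R * (y \in val A)%:R = (e x y)%:R :> R.
Proof.
move=> xy.
have xyA (A : edge_t e) : x \in val A -> y \in val A -> val A = [set x; y].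
  move=> xA yA; apply/eqP; rewrite eq_sym eqEcard card_edge cards2 xy leqnn andbT.
  by apply/subsetP => z; rewrite !inE => /orP[]/eqP->.
have [exy|nexy] := boolP (e x y).
  have P : is_edge e [set x; y].
    by apply/existsP; exists x; apply/existsP; exists y; rewrite exy eqxx.
  rewrite (bigD1 (exist (fun A => is_edge e A) _ P : edge_t e)) //= !inE !eqxx orbT mulr1 big1 ?addr0 //.
  move=> A AP; rewrite -natrM mulnb; case: andP => // -[xA yA].
  by case/eqP: AP; apply: val_inj; rewrite /= xyA.
rewrite big1 // => A _; rewrite -natrM mulnb; case: andP => // -[xA yA].
case/negP: nexy; have := xyA A xA yA; have [u [v [euv _ ->]]] := edge_tP A.
by move/eqP; rewrite eq_set2 => /orP[]/andP[/eqP<- /eqP<-]; rewrite // e_simple.1.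
Qed.

Lemma sum_adjacent x : \sum_y (e x y)%:R = (deg e x)%:R :> R.
Proof.
rewrite -natr_sum /deg -sum1dep_card; congr _%:R; rewrite [RHS]big_mkcond.
by apply: eq_bigr => y _; case: (e x y).
Qed.

(** Double counting: each edge at [x] has exactly one other end, and each neighbour of [x] comes
    from exactly one edge. *)
Lemma sum_incident x : \sum_(A : edge_t e) (x \in val A)%:R = (deg e x)%:R :> R.
Proof.
rewrite -sum_adjacent (bigD1 x) //= e_simple.2 add0r.
under [RHS]eq_bigr => y yx do rewrite -(sum_edges_pair (x := x)) 1?eq_sym //.
rewrite exchange_big /=; apply: eq_bigr => A _; rewrite -mulr_sumr.
have := sum_edge_vertices A; rewrite (bigD1 x) //=.
case: (x \in val A) => /=; last by rewrite mul0r.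
by rewrite mul1r -[2]/(1 + 1) => /addrI ->; rewrite mulr1n.
Qed.

End Incidence.

Lemma card_edge_t (V : finType) (e : rel V) : #|{: edge_t e}| = #|edge_set e|.
Proof. by rewrite card_sig; apply: eq_card => A; rewrite !inE. Qed.

Lemma adj_mx_nlap (R : rcfType) n (e : rel 'I_n) r : regular e r -> (0 < r)%N ->
  adj_mx R e = r%:R%:M - r%:R *: nlap R e.
Proof.
move=> er r0; apply/matrixP => i j; rewrite !mxE !er -expr2 sqr_sqrtr ?ler0n //.
have : (r%:R : R) != 0 by rewrite pnatr_eq0 -lt0n.
by move=> ?; rewrite -mulr_natr; field.
Qed.

(** * Subdivision joins *)

Section Joins.

Variables (R : rcfType) (n1 n2 : nat) (e1 : rel 'I_n1) (e2 : rel 'I_n2).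

(** The order is original vertices, subdivision vertices, then [G2], so that matrices indexed this
    way split into blocks. *)
Definition join_enum (i : 'I_(n1 + #|{: edge_t e1}| + n2)) : join_vert n2 e1 :=
  match split i with
  | inl j => inl match split j with inl x => inl x | inr a => inr (enum_val a) end
  | inr y => inr y
  end.

Definition join_rank (v : join_vert n2 e1) : 'I_(n1 + #|{: edge_t e1}| + n2) :=
  match v with
  | inl (inl x) => lshift _ (lshift _ x)
  | inl (inr A) => lshift _ (rshift _ (enum_rank A))
  | inr y => rshift _ y
  end.

Lemma join_rankK : cancel join_rank join_enum.
Proof.
case=> [[x|A]|y]; rewrite /join_enum /join_rank.
- by rewrite !(unsplitK (inl _)).
- by rewrite (unsplitK (inl _)) (unsplitK (inr _)) enum_rankK.
by rewrite (unsplitK (inr _)).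
Qed.

Lemma join_enum_bij : bijective join_enum.
Proof.
exists join_rank; last exact: join_rankK.
move=> i; rewrite /join_enum -[RHS]splitK; case: (split i) => [j|y] //=.
by rewrite -[in RHS](splitK j); case: (split j) => [x|a] //=; rewrite enum_valK.
Qed.

(* [p] and [q] tell whether the original, resp. the subdivision vertices of [S(G1)]
   are joined to [G2]: [svjoin] is [(true, false)] and [sejoin] is [(false, true)]. *)
Definition subdivision_join (p q : bool) : rel (join_vert n2 e1) :=
  fun a b =>
    match a, b with
    | inl (inl x), inl (inr A) => x \in val A
    | inl (inr A), inl (inl x) => x \in val A
    | inr y, inr y' => e2 y y'
    | inl (inl _), inr _ => p
    | inr _, inl (inl _) => p
    | inl (inr _), inr _ => q
    | inr _, inl (inr _) => q
    | _, _ => false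
    end.

Lemma det_join_lblock (F : join_vert n2 e1 -> join_vert n2 e1 -> R) :
  (forall a y, F (inl a) (inr y) = 0) ->
  \det (\matrix_(i, j) F (join_enum i) (join_enum j)) =
    \det (block_mx (\matrix_(x, x') F (inl (inl x)) (inl (inl x')))
                   (\matrix_(x, a) F (inl (inl x)) (inl (inr (enum_val a))))
                   (\matrix_(a, x) F (inl (inr (enum_val a))) (inl (inl x)))
                   (\matrix_(a, a' < #|{: edge_t e1}|)
                       F (inl (inr (enum_val a))) (inl (inr (enum_val a'))))) *
    \det (\matrix_(y, y') F (inr y) (inr y')).
Proof.
move=> F0.
rewrite -(det_lblock _ (\matrix_(y, i) F (inr y) (join_enum (lshift _ i)))).
congr (\det _); apply/matrixP => i j; rewrite [LHS]mxE /join_enum.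
rewrite -[in RHS](splitK i) -[in RHS](splitK j).
case: (split i) (split j) => [i'|y] [j'|y'] /=; 
  rewrite ?block_mxEul ?block_mxEur ?block_mxEdl ?block_mxEdr.
- rewrite -[in RHS](splitK i') -[in RHS](splitK j').
  by case: (split i') (split j') => [x|a] [x'|a'] /=;
    rewrite ?block_mxEul ?block_mxEur ?block_mxEdl ?block_mxEdr mxE.
- by rewrite mxE F0.
- by rewrite mxE /join_enum (unsplitK (inl _)).
- by rewrite mxE.
Qed.

Hypotheses (e1_simple : simple_graph e1) (e2_simple : simple_graph e2).
Variables (r1 r2 : nat).
Hypotheses (e1_reg : regular e1 r1) (e2_reg : regular e2 r2).

Let B : 'M[R]_(n1, #|{: edge_t e1}|) :=
  \matrix_(x < n1, a < #|{: edge_t e1}|) (x \in val (enum_val a))%:R.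

Lemma incidence_mul_tr : B *m B^T = r1%:R%:M + adj_mx R e1.
Proof.
apply/matrixP => x y; rewrite !mxE.
transitivity (\sum_(A : edge_t e1) (x \in val A)%:R * (y \in val A)%:R : R).
  rewrite [RHS](reindex (@enum_val _ {: edge_t e1})) /=; last first.
    exact/onW_bij/enum_val_bij.
  by apply: eq_bigr => a _; rewrite !mxE.
have [->|xy] := eqVneq x y; last by rewrite sum_edges_pair // add0r.
rewrite e1_simple.2 addr0 -(e1_reg y) mulr1n -sum_incident //; apply: eq_bigr => A _.
by case: (_ \in _); rewrite ?mulr1 ?mulr0.
Qed.

Lemma subdivision_join_sym p q : symmetric (subdivision_join p q).
Proof. by case=> [[x|A]|y] [[x'|A']|y'] //=; apply: e2_simple.1. Qed.

(** The left side is the matrix-tree formula with weights [u] and [v]. On the right, the [S(G1)]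
    block is a bipartite block with diagonals [r1 + p n2] and [2 + q n2], and the [G2] block is
    untouched because [u] vanishes there. *)
Lemma subdivision_join_count (p q : bool) (J : rel (join_vert n2 e1)) :
  J =2 subdivision_join p q -> (0 < n1 + #|edge_set e1| + n2)%N ->
  (p%:R * n1%:R + q%:R * #|edge_set e1|%:R) * n2%:R * (num_spanning_trees J)%:R =
    (2 + q%:R * n2%:R) ^ (#|edge_set e1|%:Z - n1%:Z) *
    \det (((r1%:R + p%:R * n2%:R) * (2 + q%:R * n2%:R) - r1%:R)%:M - adj_mx R e1) *
    \det ((p%:R * n1%:R + q%:R * #|edge_set e1|%:R + r2%:R)%:M - adj_mx R e2) :> R.
Proof.
move=> JE n_gt0; rewrite -card_edge_t in n_gt0 *.
set m := #|{: edge_t e1}|.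
have J_sym : symmetric J by move=> a b; rewrite !JE subdivision_join_sym.
pose u (a : join_vert n2 e1) : R :=
  match a with inl (inl _) => p%:R | inl (inr _) => q%:R | inr _ => 0 end.
pose v (a : join_vert n2 e1) : R := match a with inr _ => 1 | _ => 0 end.
have sum_u : \sum_a u a = p%:R * n1%:R + q%:R * m%:R.
  rewrite !big_sumType /= !sumr_const !card_ord mul0rn addr0.
  by rewrite !mulr_natr.
have sum_v : \sum_a v a = n2%:R.
  by rewrite !big_sumType /= !sumr_const !card_ord !mul0rn !add0r.
rewrite -sum_u -sum_v -(matrix_tree join_enum_bij u v J_sym n_gt0).
have degE a : \sum_z (J a z)%:R = match a with
    | inl (inl x) => r1%:R + p%:R * n2%:R
    | inl (inr A) => 2 + q%:R * n2%:R
    | inr y => p%:R * n1%:R + q%:R * m%:R + r2%:R end :> R.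
  under eq_bigr => z _ do rewrite JE.
  rewrite !big_sumType /=; case: a => [[x|A]|y] /=.
  - by rewrite sum_incident // e1_reg !sumr_const !card_ord mulr0n mul0rn add0r mulr_natr.
  - by rewrite (sum_edge_vertices R e1_simple A) !sumr_const !card_ord mulr0n mul0rn addr0 mulr_natr.
  by rewrite (sum_adjacent _ e2 y) e2_reg !sumr_const !card_ord !mulr_natr.
pose F a b : R := laplacian R J a b + u a * v b.
rewrite (@det_join_lblock F); last first.
  (* From [S(G1)] to [G2] the Laplacian entry is minus the value of [u], and [v] is 1, so the two
     cancel. *)
  by move=> [x|A] y; rewrite /F /laplacian JE /= mul0r sub0r mulr1 addNr.
rewrite sum_u sum_v; congr (_ * _).
  have b0 : 2 + q%:R * n2%:R != 0 :> R.
    by rewrite -natrM -natrD pnatr_eq0.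
  have -> : ((r1%:R + p%:R * n2%:R) * (2 + q%:R * n2%:R) - r1%:R)%:M - adj_mx R e1
      = ((r1%:R + p%:R * n2%:R) * (2 + q%:R * n2%:R))%:M - B *m B^T :> 'M[R]_n1.
    by rewrite incidence_mul_tr raddfB /= opprD addrA.
  rewrite -det_bipartite_block //; congr (\det (block_mx _ _ _ _));
    apply/matrixP => i j; rewrite !mxE /F /laplacian JE degE /= mulr0 addr0.
  - by rewrite subr0 -[inl _ == _]/(i == j) mulr_natl.
  - by rewrite mul0r sub0r.
  - by rewrite mul0r sub0r.
  - rewrite subr0 -[inl _ == _]/(enum_val i == enum_val j).
    by rewrite (inj_eq enum_val_inj) mulr_natl.
congr (\det _); apply/matrixP => i j; rewrite !mxE /F /laplacian JE degE /=.
by rewrite mul0r addr0 -[inr _ == _]/(i == j) mulr_natl.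
Qed.
End Joins.

(** * Evaluation of both counts at the normalized Laplacian spectra *)

Theorem theorem3p4 (R : rcfType) (n1 n2 r1 r2 m1 : nat)
  (e1 : rel 'I_n1) (e2 : rel 'I_n2)
  (mu nu : seq R) :
  simple_graph e1 -> simple_graph e2 ->
  regular e1 r1 -> regular e2 r2 ->
  (1 <= r1)%N -> (1 <= r2)%N ->
  #|edge_set e1| = m1 ->
  (* normalized Laplacian eigenvalues: 0 = mu_1, mu_2, ..., mu_{n1} where
     mu = [:: mu_2; ...; mu_{n1}] (similarly for nu) *)
  char_poly (nlap R e1) = 'X * \prod_(x <- mu) ('X - x%:P) ->
  char_poly (nlap R e2) = 'X * \prod_(x <- nu) ('X - x%:P) ->
  ((num_spanning_trees (svjoin e1 e2))%:R =
     (2 : R) ^ (m1%:Z - n1%:Z + 1)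
     * \prod_(x <- mu) (2 * n2%:R + r1%:R * x)
     * \prod_(y <- nu) (n1%:R + r2%:R * y))
  /\
  ((num_spanning_trees (sejoin e1 e2))%:R =
     (r1%:R : R) ^+ n1 * (2 + n2%:R : R) ^ (m1%:Z - n1%:Z)
     * \prod_(x <- mu) (n2%:R + x)
     * \prod_(y <- nu) (m1%:R + r2%:R * y)).
Proof.
move=> sg1 sg2 reg1 reg2 r1_gt0 r2_gt0 <- chi1 chi2; set m := #|edge_set e1|.
have En1 := size_char_poly_roots chi1; have En2 := size_char_poly_roots chi2.
have n1_gt0 : (0 < n1)%N by rewrite En1.
(* An edge exists because [r1] is positive; the second formula is obtained by cancelling
   [m * n2]. *)
have m_gt0 : (0 < m)%N.
  have x : 'I_n1 := Ordinal n1_gt0.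
  have : (0 < #|[set w | e1 x w]|)%N by rewrite -[#|_|]/(deg e1 x) reg1.
  rewrite !card_gt0 => /set0Pn[y]; rewrite inE => exy.
  apply/set0Pn; exists [set x; y]; rewrite inE.
  by apply/existsP; exists x; apply/existsP; exists y; rewrite exy eqxx.
have n1R : n1%:R != 0 :> R by rewrite pnatr_eq0 -lt0n.
have n2R : n2%:R != 0 :> R by rewrite pnatr_eq0 En2.
have mR : m%:R != 0 :> R by rewrite pnatr_eq0 -lt0n.
have r1R : r1%:R != 0 :> R by rewrite pnatr_eq0 -lt0n.
have r2R : r2%:R != 0 :> R by rewrite pnatr_eq0 -lt0n.
have n_gt0 : (0 < n1 + m + n2)%N by rewrite En1.
(* By regularity, the matrix is [c] plus [r2] times the normalized Laplacian. *)
have det2 (c : R) : \det ((c + r2%:R)%:M - adj_mx R e2) = c * \prod_(y <- nu) (c + r2%:R * y).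
  rewrite -(det_scalar_add_char_poly c r2R chi2) (adj_mx_nlap R reg2 r2_gt0).
  by rewrite raddfD /= opprB addrACA subrr addr0.
have det1 (c : R) : \det ((c + r1%:R)%:M - adj_mx R e1) = c * \prod_(x <- mu) (c + r1%:R * x).
  rewrite -(det_scalar_add_char_poly c r1R chi1) (adj_mx_nlap R reg1 r1_gt0).
  by rewrite raddfD /= opprB addrACA subrr addr0.
split.
  have JE : svjoin e1 e2 =2 subdivision_join e2 true false.
    by case=> [[x|A]|y] [[x'|A']|y'].
  have := subdivision_join_count R sg1 sg2 reg1 reg2 JE n_gt0.
  rewrite -/m !mul0r !mul1r !addr0 det2.
  have -> : (r1%:R + n2%:R) * 2 - r1%:R = 2 * n2%:R + r1%:R :> R by ring.
  (* Here [c] is [2 * n2] for [G1] and [n1] for [G2]; after cancelling [n1 * n2] the remaining 2 is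
     the [+ 1] in the exponent. *)
  rewrite det1 => tE; apply: (mulfI (mulf_neq0 n1R n2R)); rewrite tE.
  rewrite [2 ^ (_ + 1)]expfzDr ?pnatr_eq0 // expr1z.
  by move: (2 ^ _) (\prod_(x <- mu) _) (\prod_(y <- nu) _) => a b c; ring.
have JE : sejoin e1 e2 =2 subdivision_join e2 false true.
  by case=> [[x|A]|y] [[x'|A']|y'].
have := subdivision_join_count R sg1 sg2 reg1 reg2 JE n_gt0.
rewrite -/m !mul0r !mul1r !addr0 !add0r det2.
have -> : r1%:R * (2 + n2%:R) - r1%:R = r1%:R * n2%:R + r1%:R :> R by ring.
rewrite det1 => tE; apply: (mulfI (mulf_neq0 mR n2R)); rewrite tE.
(* Each of the [n1 - 1] factors yields one [r1]; the leading factor [r1 * n2] supplies the last one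
   of [r1 ^+ n1]. *)
have -> : \prod_(x <- mu) (r1%:R * n2%:R + r1%:R * x) =
    r1%:R ^+ size mu * \prod_(x <- mu) (n2%:R + x) :> R.
  elim: (mu) => [|x t IH] /=; first by rewrite !big_nil mulr1.
  by rewrite !big_cons IH exprS; ring.
rewrite [in r1%:R ^+ n1]En1 exprS.
move: (_ ^ _) (_ ^+ _) (\prod_(x <- mu) _) (\prod_(y <- nu) _) => a b c d; ring.
Qed.
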